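(* Let $L=(L_t)_{t\ge0}$ be a Lévy process on $\mathbb R^d$ with characteristic exponent $\psi$ and Lévy measure $\nu$. Assume that $\int_{|z|\ge1}|z|^\beta\,\nu(\mathrm dz)<\infty$ for some $\beta>0$. Then: (1) If $\beta\ge1$, $\psi$ is $\mathcal C^1$; in particular, it is locally Lipschitz continuous. (2) If $\beta\in(0,1)$, $\psi$ is locally Hölder continuous with Hölder index $\beta$.
   Context: The characteristic exponent $\psi:\mathbb R^d\to\mathbb C$ of $L$ is the continuous function with $\psi(0)=0$ and $\mathbb E[e^{i\langle u,L_t\rangle}]=e^{t\psi(u)}$ for all $u\in\mathbb R^d$, $t\ge0$. ''Locally'' means on each bounded subset of $\mathbb R^d$ (with a constant depending on the subset). *)

(* Defs.v *)
From HB Require Import structures.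
From mathcomp Require Export all_boot all_order all_algebra.
From mathcomp Require Export complex.
From mathcomp Require Export all_classical all_reals all_analysis.

Set Implicit Arguments.
Unset Strict Implicit.
Unset Printing Implicit Defensive.

Import Order.TTheory GRing.Theory Num.Theory.
Import numFieldNormedType.Exports.

Local Open Scope classical_set_scope.
Local Open Scope ring_scope.
Local Open Scope complex_scope.

Definition dotp (R : realType) (d : nat) (u v : 'rV[R]_d) : R :=
  \sum_i u 0 i * v 0 i.

(* The norm `|x| of the library on 'rV[R]_d is the sup norm. *)
Definition enorm (R : realType) (d : nat) (x : 'rV[R]_d) : R :=
  Num.sqrt (dotp x x).

Definition borelRd (R : realType) (d : nat) :=
  g_sigma_algebraType (@open 'rV[R]_d).

Definition cexp (R : realType) (z : R[i]) : R[i] :=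
  (expR (complex.Re z))%:C * (cos (complex.Im z) +i* sin (complex.Im z)).

Definition cintegral (R : realType) (dT : measure_display)
    (T : measurableType dT) (mu : {measure set T -> \bar R})
    (f : T -> R[i]) : R[i] :=
  (\int[mu]_(x in setT) complex.Re (f x))
    +i* (\int[mu]_(x in setT) complex.Im (f x)).

Section levy.
Variables (R : realType) (d : nat) (dT : measure_display).
Variables (T : measurableType dT) (P : probability T R).
Implicit Types (L : R -> T -> 'rV[R]_d) (psi : 'rV[R]_d -> R[i]).
Implicit Types (nu : {measure set (borelRd R d) -> \bar R}).

Definition charfun (X : T -> 'rV[R]_d) (u : 'rV[R]_d) : R[i] :=
  cintegral P (fun w => cexp ('i%C * (dotp u (X w))%:C)).

(* Products over all i < n suffice for mutual independence, as B i may be setT. *)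
Definition independent_increments L : Prop :=
  forall (n : nat) (t : nat -> R) (B : nat -> set (borelRd R d)),
    0 <= t 0%N ->
    (forall i, (i < n)%N -> t i <= t i.+1) ->
    (forall i, measurable (B i)) ->
    P (\bigcap_(i < n) [set w | B i (L (t i.+1) w - L (t i) w)]) =
    (\prod_(i < n) P [set w | B i (L (t i.+1) w - L (t i) w)%R])%E.

Definition stationary_increments L : Prop :=
  forall (s t : R) (B : set (borelRd R d)),
    0 <= s -> 0 <= t -> measurable B ->
    P [set w | B (L (s + t) w - L s w)] = P [set w | B (L t w)].

Definition stochastically_continuous L : Prop :=
  forall t eps : R, 0 <= t -> 0 < eps ->
    P [set w | eps < enorm (L s w - L t w)]
      @[s --> within [set s | 0 <= s] (nbhs t)] --> 0%E.

Definition cadlag (x : R -> 'rV[R]_d) : Prop :=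
  (forall t : R, 0 <= t -> x s @[s --> t^'+] --> x t) /\
  (forall t : R, 0 < t -> cvg (x s @[s --> t^'-])).

(* Time is [0, +oo[: the values of L at negative times are irrelevant. *)
Definition levy_process L : Prop :=
  [/\ forall t : R, 0 <= t ->
        measurable_fun [set: T] (L t : T -> borelRd R d),
      {ae P, forall w, L 0 w = 0},
      independent_increments L /\ stationary_increments L,
      stochastically_continuous L &
      {ae P, forall w, cadlag (L ^~ w)}].

(* R[i]^o carries the topology of the modulus. *)
Definition characteristic_exponent L psi : Prop :=
  [/\ continuous (psi : 'rV[R]_d -> R[i]^o),
      psi 0 = 0 &
      forall u (t : R), 0 <= t -> charfun (L t) u = cexp (t%:C * psi u)].

(* Lévy-Khintchine exponent of the triplet (b, Q, nu). *)
Definition levy_khintchine (b : 'rV[R]_d) (Q : 'M[R]_d) nu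
    (u : 'rV[R]_d) : R[i] :=
  'i%C * (dotp b u)%:C - (2^-1 * dotp (u *m Q) u)%:C
  + cintegral nu (fun z : borelRd R d =>
      cexp ('i%C * (dotp u z)%:C) - 1
      - 'i%C * (dotp u z * (enorm (z : 'rV[R]_d) < 1)%R%:R)%:C).

(* The jump component of the characteristic triplet of L; it is unique, and
   the choice of the truncation function only affects b. *)
Definition levy_measure L nu : Prop :=
  [/\ nu [set 0] = 0%E,
      (\int[nu]_z (Num.min 1 (enorm (z : 'rV[R]_d) ^+ 2))%:E < +oo)%E &
      exists (b : 'rV[R]_d) (Q : 'M[R]_d),
        [/\ Q^T = Q,
            forall u : 'rV[R]_d, 0 <= dotp (u *m Q) u &
            forall u (t : R), 0 <= t ->
              charfun (L t) u = cexp (t%:C * levy_khintchine b Q nu u)]].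

End levy.

(* In finite dimension, continuity of x |-> 'd f x in operator norm amounts to
   continuity of x |-> 'd f x v for each v. *)
Definition C1 (R : realType) (d : nat) (f : 'rV[R]_d -> R^o) : Prop :=
  (forall x, differentiable f x) /\
  (forall v, continuous (fun x => 'd f x v)).

(* As R[i] is not a normed space over R in the library, real and imaginary
   parts are used. *)
Definition C1_complex (R : realType) (d : nat) (f : 'rV[R]_d -> R[i]) : Prop :=
  C1 (fun x => complex.Re (f x)) /\ C1 (fun x => complex.Im (f x)).

Definition locally_lipschitz (R : realType) (d : nat)
    (f : 'rV[R]_d -> R[i]) : Prop :=
  forall B : set 'rV[R]_d, bounded_set B ->
    exists C : R, forall x y, B x -> B y ->
      ComplexField.Normc.normc (f x - f y) <= C * enorm (x - y).

Definition locally_holder (R : realType) (d : nat) (a : R)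
    (f : 'rV[R]_d -> R[i]) : Prop :=
  forall B : set 'rV[R]_d, bounded_set B ->
    exists C : R, forall x y, B x -> B y ->
      ComplexField.Normc.normc (f x - f y) <= C * enorm (x - y) `^ a.

(* Main.v *)
From HB Require Import structures.
Require Import Defs.
From mathcomp Require Import measurable_realfun ring lra.
Set Implicit Arguments.
Unset Strict Implicit.
Unset Printing Implicit Defensive.

Import Order.TTheory GRing.Theory Num.Theory.
Import numFieldNormedType.Exports.

Local Open Scope classical_set_scope.
Local Open Scope ring_scope.
Local Open Scope complex_scope.

(** Since exp(t psi) and exp(t eta) agree for all t >= 0, psi is the
    Lévy-Khintchine exponent eta. Its real and imaginary parts are polynomials
    plus integrals of F(u.z) - F(0) - G(0) (u.z) 1_{|z| < 1} for F = cos, sin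
    and G = F'. As G is bounded and Lipschitz, increments in u of this integrand
    are O(|x - y| |z|^2) for small jumps and O(|x - y|^a |z|^a) with
    a = min(beta, 1) for large ones, whence the Hölder and Lipschitz bounds.
    For beta >= 1, both the first-order Taylor remainder, divided by |h|, and
    the variation of the gradient are bounded by the integral of
    min(2 |z|, r |z|^2), which tends to 0 with r by dominated convergence. *)

(** * Euclidean inner product and norm, compared with the sup norm *)

Section dot_product.
Context {R : realType} {d : nat}.
Implicit Types u v w : 'rV[R]_d.

Lemma dotpC u v : dotp u v = dotp v u.
Proof. by apply: eq_bigr => i _; rewrite mulrC. Qed.

Lemma dotpDl u v w : dotp (u + v) w = dotp u w + dotp v w.
Proof. by rewrite -big_split; apply: eq_bigr => i _; rewrite mxE mulrDl. Qed.

Lemma dotpZl (a : R) u v : dotp (a *: u) v = a * dotp u v.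
Proof. by rewrite /dotp mulr_sumr; apply: eq_bigr => i _; rewrite mxE mulrA. Qed.

Lemma dotpBl u v w : dotp (u - v) w = dotp u w - dotp v w.
Proof. by rewrite dotpDl -scaleN1r dotpZl mulN1r. Qed.

Lemma dotpDr u v w : dotp w (u + v) = dotp w u + dotp w v.
Proof. by rewrite dotpC dotpDl !(dotpC w). Qed.

Lemma dotpZr (a : R) u v : dotp v (a *: u) = a * dotp v u.
Proof. by rewrite dotpC dotpZl (dotpC v). Qed.

Lemma dotp0l u : dotp 0 u = 0.
Proof. by rewrite -(scale0r 0) dotpZl mul0r. Qed.

Lemma dotp_ge0 u : 0 <= dotp u u.
Proof. by apply: sumr_ge0 => i _; rewrite -expr2 sqr_ge0. Qed.

Lemma dotp_eq0 u v : dotp v v = 0 -> dotp u v = 0.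
Proof.
move=> vv0; apply: big1 => i _.
have : v 0 i * v 0 i <= 0.
  rewrite -[leRHS]vv0 /dotp (bigD1 i) //= lerDl.
  by apply: sumr_ge0 => j _; rewrite -expr2 sqr_ge0.
rewrite -expr2 => v2_le0; suff : v 0 i ^+ 2 == 0.
  by rewrite sqrf_eq0 => /eqP ->; rewrite mulr0.
by rewrite eq_le v2_le0 sqr_ge0.
Qed.

Lemma enorm_ge0 u : 0 <= enorm u.
Proof. exact: sqrtr_ge0. Qed.

Lemma enormN u : enorm (- u) = enorm u.
Proof. by rewrite /enorm -scaleN1r dotpZl dotpC dotpZl !mulN1r opprK. Qed.

Lemma sqr_enorm u : enorm u ^+ 2 = dotp u u.
Proof. by rewrite sqr_sqrtr ?dotp_ge0. Qed.

(** Cauchy-Schwarz. When [dotp v v] is positive, it comes from the nonnegative square of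
    [dotp v v *: u - dotp u v *: v], which factors as [dotp v v] times the defect. *)
Lemma ler_norm_dotp u v : `|dotp u v| <= enorm u * enorm v.
Proof.
have le_sqr : dotp u v ^+ 2 <= dotp u u * dotp v v.
  have [vv0|vv0] := eqVneq (dotp v v) 0.
    by rewrite vv0 (dotp_eq0 _ vv0) expr0n mulr0.
  have vv_gt0 : 0 < dotp v v by rewrite lt_neqAle eq_sym vv0 dotp_ge0.
  have := dotp_ge0 (dotp v v *: u - dotp u v *: v).
  rewrite dotpBl !dotpZl !(dotpC _ (_ - _)) !dotpBl !dotpZl (dotpC v u).
  rewrite (_ : _ - _ = dotp v v * (dotp u u * dotp v v - dotp u v ^+ 2)).
    by rewrite pmulr_rge0 // subr_ge0.
  by ring.
rewrite -ler_sqr ?nnegrE ?mulr_ge0 ?enorm_ge0 //.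
by rewrite exprMn !sqr_enorm real_normK ?num_real.
Qed.

Lemma ler_enormB u v : enorm (u - v) <= enorm u + enorm v.
Proof.
rewrite -ler_sqr ?nnegrE ?addr_ge0 ?enorm_ge0 // sqrrD !sqr_enorm.
rewrite dotpBl !(dotpC _ (u - v)) !dotpBl (dotpC v u).
have := ler_norm_dotp u v; rewrite ler_norml => /andP[]; lra.
Qed.

Lemma ler_norm_enorm u : `|u| <= enorm u.
Proof.
rewrite /Num.norm /= mx_normrE; apply/bigmax_leP.
split=> [|[i j] _ /=]; first exact: enorm_ge0.
rewrite ord1 -ler_sqr ?nnegrE ?enorm_ge0 // sqr_enorm real_normK ?num_real //.
rewrite /dotp (bigD1 j) //= -expr2 lerDl.
by apply: sumr_ge0 => k _; rewrite -expr2 sqr_ge0.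
Qed.

Lemma ler_coord_norm u i : `|u 0 i| <= `|u|.
Proof.
rewrite {2}/Num.norm /= mx_normrE.
exact: (@le_bigmax _ _ _ 0 (fun ij : 'I_1 * 'I_d => `|u ij.1 ij.2|) (0, i)).
Qed.

Lemma ler_enorm_norm u : enorm u <= Num.sqrt d%:R * `|u|.
Proof.
rewrite -ler_sqr ?nnegrE ?enorm_ge0 ?mulr_ge0 ?sqrtr_ge0 //.
rewrite exprMn sqr_enorm sqr_sqrtr ?ler0n //.
have -> : d%:R * `|u| ^+ 2 = \sum_(i < d) `|u| ^+ 2.
  by rewrite sumr_const card_ord mulr_natl.
apply: ler_sum => i _; rewrite -expr2 -(@real_normK _ (u 0 i)) ?num_real //.
by rewrite ler_sqr ?nnegrE // ler_coord_norm.
Qed.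

Lemma continuous_dotp v : continuous (fun u => dotp u v).
Proof.
apply: continuous_big => [|i _ u]; first exact: add_continuous.
by apply: continuousM; [exact: coord_continuous | exact: cst_continuous].
Qed.

Lemma continuous_enorm : continuous (@enorm R d).
Proof.
have cdotp : continuous (fun u : 'rV[R]_d => dotp u u).
  apply: continuous_big => [|i _ u]; first exact: add_continuous.
  by apply: continuousM; exact: coord_continuous.
move=> u; apply: (@continuous_comp _ _ _ (fun v : 'rV[R]_d => dotp v v) Num.sqrt).
  exact: cdotp.
exact: sqrt_continuous.
Qed.

(** Preimages of open intervals are open, hence among the generators of the Borel sets. *)
Lemma continuous_measurable_borelRd (f : 'rV[R]_d -> R) :
  continuous f -> measurable_fun [set: borelRd R d] (f : borelRd R d -> R).
Proof.
move=> cf; apply: (measurability _ (RGenOpens.measurableE R)).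
move=> _ [_ [a [b ->]] <-]; rewrite setTI; apply: sub_sigma_algebra.
move/continuousP : cf; apply; exact: interval_open.
Qed.

Lemma measurable_dotp u :
  measurable_fun [set: borelRd R d] (dotp u : borelRd R d -> R).
Proof.
apply: continuous_measurable_borelRd.
rewrite (_ : dotp u = fun v => dotp v u); first exact: continuous_dotp.
by apply/funext => v; exact: dotpC.
Qed.

Lemma measurable_enorm :
  measurable_fun [set: borelRd R d] (@enorm R d : borelRd R d -> R).
Proof. apply: continuous_measurable_borelRd; exact: continuous_enorm. Qed.

End dot_product.

(** The mean value theorem for [a] and [b] in either order. The location of [c] is kept because the
    Lipschitz bound on the derivative is applied at [c] later. *)
Lemma is_derive_mean_value {R : realType} (F G : R -> R) (a b : R) :
  (forall x : R, is_derive x 1 F (G x)) ->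
  exists2 c, `|c - b| <= `|a - b| & F a - F b = G c * (a - b).
Proof.
move=> dF; have cF : continuous F.
  by move=> x; apply: differentiable_continuous; apply/derivable1_diffP.
have [ab|/ltW ba] := leP a b.
  have [c] := MVT_segment ab (fun x _ => dF x) (continuous_subspaceT cF).
  rewrite in_itv /= => /andP[ac cb] Fab; exists c; last lra.
  by rewrite !ler0_norm ?subr_le0 // lerN2 lerD2r.
have [c] := MVT_segment ba (fun x _ => dF x) (continuous_subspaceT cF).
rewrite in_itv /= => /andP[bc ca] Fab; exists c => //.
by rewrite !ger0_norm ?subr_ge0 // lerD2r.
Qed.

(** For [r <= 1] the power only increases [r]; for [r > 1] the power is at least 1 and [K] alone
    suffices. This absorbs Lipschitz terms into Hölder terms on bounded ranges. *)
Lemma le_powR_mul {R : realType} (r K a : R) :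
  0 <= r -> 1 <= K -> r <= K -> 0 <= a <= 1 -> r <= K * r `^ a.
Proof.
move=> r_ge0 K_ge1 rK /andP[a0 a1].
have K_ge0 : 0 <= K by apply: le_trans K_ge1.
have [r0|r_neq0] := eqVneq r 0; first by rewrite r0 mulr_ge0 ?powR_ge0.
have r_gt0 : 0 < r by rewrite lt_neqAle eq_sym r_neq0.
have [r1|/ltW r1] := leP r 1.
  apply: (@le_trans _ _ (r `^ a)); first by rewrite ger1_powR // r_gt0.
  by rewrite ler_peMl ?powR_ge0.
apply: (le_trans rK); rewrite ler_peMr //.
by rewrite -[leLHS](powRr0 r) ler_powR.
Qed.

(** * Increments and Taylor remainders of a bounded function with bounded Lipschitz derivative *)

Section smooth_kernel.
Context {R : realType} (F G : R -> R).
Hypothesis dF : forall x : R, is_derive x 1 F (G x).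
Hypothesis F_le1 : forall x, `|F x| <= 1.
Hypothesis G_le1 : forall x, `|G x| <= 1.
Hypothesis G_lip : forall x y, `|G x - G y| <= `|x - y|.

Lemma kernel_lipschitz a b : `|F a - F b| <= `|a - b|.
Proof.
have [c _ ->] := is_derive_mean_value a b dF.
by rewrite normrM ler_piMl.
Qed.

Lemma kernel_bounded a b : `|F a - F b| <= 2.
Proof. by have := ler_normB (F a) (F b); have := F_le1 a; have := F_le1 b; lra. Qed.

(** The left side is [(G c - G 0) * (a - b)] with [c] between [a] and [b], and
    [|c| <= |a - b| + |b|]. *)
Lemma kernel_compensated a b :
  `|F a - F b - G 0 * (a - b)| <= 2 * (`|a| + `|b|) * `|a - b|.
Proof.
have [c cb ->] := is_derive_mean_value a b dF.
rewrite -mulrBl normrM ler_wpM2r //.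
have := G_lip c 0; rewrite subr0 => /le_trans; apply.
have := ler_normD (c - b) b; rewrite subrK.
have := ler_normB a b; have := normr_ge0 a; have := normr_ge0 b; lra.
Qed.

(** Interpolation: the Lipschitz bound is used up to distance 2, the uniform bound 2 beyond it. *)
Lemma kernel_holder al a b : 0 <= al <= 1 -> `|F a - F b| <= 2 * `|a - b| `^ al.
Proof.
move=> al01; have [ab|/ltW ab] := leP `|a - b| 2.
  apply: le_trans (kernel_lipschitz a b) _.
  by apply: le_powR_mul => //; rewrite ler1n.
apply: le_trans (kernel_bounded a b) _; rewrite ler_peMr //.
rewrite -[leLHS](powRr0 `|a - b|) ler_powR //; last by case/andP: al01.
by apply: le_trans ab; rewrite ler1n.
Qed.

(** The remainder is [(G c - G a) * s]: boundedness of [G] gives the first bound, its Lipschitz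
    property the second. *)
Lemma kernel_taylor a s :
  `|F (s + a) - F a - G a * s| <= Num.min (2 * `|s|) (`|s| ^+ 2).
Proof.
have [c cb ->] := is_derive_mean_value (s + a) a dF.
rewrite addrK in cb *; rewrite -mulrBl normrM le_min; apply/andP; split.
  rewrite ler_wpM2r //; apply: le_trans (ler_normB _ _) _.
  by have := G_le1 c; have := G_le1 a; lra.
by rewrite expr2 ler_wpM2r //; apply: le_trans (G_lip _ _) cb.
Qed.

End smooth_kernel.

(** * Integrals dominated by a multiple of an integrable function *)

Section dominated_integral.
Context {R : realType} {dT : measure_display} {T : measurableType dT}.
Context {mu : {measure set T -> \bar R}}.

Lemma le_integrableM (H g : T -> R) (C : R) :
  mu.-integrable setT (EFin \o H) -> measurable_fun setT g ->
  (forall z, `|g z| <= C * H z) -> mu.-integrable setT (EFin \o g).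
Proof.
move=> iH mg gH.
apply: (@le_integrable _ _ _ mu _ _ _ (fun z => (C%:E * (H z)%:E)%E)) => //.
- exact/measurable_EFinP.
- by move=> z _; rewrite /= lee_fin; apply: le_trans (gH z) (ler_norm _).
- exact: integrableZl.
Qed.

Lemma le_normr_RintegralM (H g : T -> R) (C : R) :
  mu.-integrable setT (EFin \o H) -> measurable_fun setT g ->
  (forall z, `|g z| <= C * H z) ->
  `|\int[mu]_z g z| <= C * \int[mu]_z H z.
Proof.
move=> iH mg gH; have ig := le_integrableM iH mg gH.
apply: le_trans (le_normr_Rintegral _ ig) _ => //.
rewrite -RintegralZl //; apply: le_Rintegral => //.
- exact: integrable_norm.
- exact: (integrableZl _ C iH).
Qed.

Lemma Rintegral_sum (I : Type) (s : seq I) (g : I -> T -> R) :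
  (forall i, mu.-integrable setT (EFin \o g i)) ->
  \int[mu]_z (\sum_(i <- s) g i z) = \sum_(i <- s) \int[mu]_z g i z.
Proof.
move=> ig; elim: s => [|i s IHs].
  under eq_Rintegral do rewrite big_nil.
  by rewrite big_nil Rintegral_cst // mul0r.
under eq_Rintegral do rewrite big_cons.
rewrite big_cons RintegralD //; first by rewrite IHs.
rewrite [X in mu.-integrable _ X](_ : _ = fun z => (\sum_(j <- s) (g j z)%:E)%E).
  by apply: (integrable_sum measurableT) => j _; exact: ig.
by apply/funext => z; rewrite /= sumEFin.
Qed.

End dominated_integral.

(** * The jump part of the exponent: majorant, increments, gradient *)

Section jump_integral.
Context {R : realType} {d : nat} {nu : {measure set (borelRd R d) -> \bar R}}.
Variable beta : R.
Hypothesis beta_gt0 : 0 < beta.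
Hypothesis nu_min :
  (\int[nu]_z (Num.min 1 (enorm (z : 'rV[R]_d) ^+ 2))%:E < +oo)%E.
Hypothesis nu_moment :
  (\int[nu]_(z in [set z : borelRd R d | (1 <= enorm (z : 'rV[R]_d))%R])
    (enorm (z : 'rV[R]_d) `^ beta)%:E < +oo)%E.

Definition small_jump (z : 'rV[R]_d) : R := (enorm z < 1)%R%:R.

(** A single majorant joining the Lévy condition, which controls small jumps, to the moment
    hypothesis on large ones. *)
Definition moment (z : 'rV[R]_d) : R :=
  Num.min 1 (enorm z ^+ 2) + enorm z `^ beta * (1 - small_jump z).

Lemma measurable_small_jump :
  measurable_fun [set: borelRd R d] (small_jump : borelRd R d -> R).
Proof.
rewrite (_ : small_jump = \1_[set z : borelRd R d | enorm (z : 'rV[R]_d) < 1]).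
  apply: measurable_indic; rewrite -[X in measurable X]setTI.
  rewrite (_ : [set z | _] = enorm (R:=R) (d:=d) @^-1` `]-oo, 1[%classic).
    by apply: measurable_enorm => //; exact: measurable_itv.
  by apply/seteqP; split=> z; rewrite /= in_itv.
by apply/funext => z; rewrite indicE mem_setE.
Qed.

Lemma moment_ge0 z : 0 <= moment z.
Proof.
rewrite /moment addr_ge0 ?le_min ?sqr_ge0 ?ler01 // mulr_ge0 ?powR_ge0 //.
by rewrite /small_jump; case: ltP => _; rewrite ?subrr ?subr0.
Qed.

(** The dichotomy behind the pointwise bounds: on each side the truncation is constant and [moment]
    has an explicit minorant. *)
Lemma small_jumpP z :
  (small_jump z = 1 /\ enorm z < 1 /\ enorm z ^+ 2 <= moment z) \/
  (small_jump z = 0 /\ 1 <= enorm z /\ 1 + enorm z `^ beta <= moment z).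
Proof.
rewrite /moment /small_jump; case: ltP => z1; [left|right].
  rewrite subrr mulr0 addr0; split=> //; split=> //.
  by rewrite le_min lexx andbT expr_le1 ?enorm_ge0 // ltW.
rewrite subr0 mulr1; split=> //; split=> //; rewrite lerD2r.
by rewrite le_min lexx andTb -(expr1n _ 2) ler_sqr ?nnegrE ?enorm_ge0.
Qed.

Lemma integrable_moment : nu.-integrable setT (EFin \o (moment : borelRd R d -> R)).
Proof.
have m1 : measurable_fun [set: borelRd R d]
    (fun z : borelRd R d => Num.min 1 (enorm (z : 'rV[R]_d) ^+ 2)).
  apply: measurable_minr; first exact: measurable_cst.
  by apply: measurable_funX; exact: measurable_enorm.
have m2 : measurable_fun [set: borelRd R d]
    (fun z : borelRd R d => enorm (z : 'rV[R]_d) `^ beta * (1 - small_jump z)).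
  apply: measurable_funM.
    apply: (measurableT_comp (measurable_powR beta)); exact: measurable_enorm.
  by apply: measurable_funB; [exact: measurable_cst|exact: measurable_small_jump].
apply: (@integrableD _ _ _ nu _ measurableT
   (fun z : borelRd R d => (Num.min 1 (enorm (z : 'rV[R]_d) ^+ 2))%:E)
   (fun z => (enorm (z : 'rV[R]_d) `^ beta * (1 - small_jump z))%:E));
  apply/integrableP; split; try exact/measurable_EFinP.
  apply: le_lt_trans nu_min; apply: ge0_le_integral => //.
  - by apply: measurableT_comp => //; exact/measurable_EFinP.
  - exact/measurable_EFinP.
  - by move=> z _; rewrite /= lee_fin ger0_norm // le_min ler01 sqr_ge0.
(* [1 - small_jump] is the indicator of the large jumps, so the two integrals coincide. *)
apply: le_lt_trans nu_moment; rewrite [leRHS]integral_mkcond.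
rewrite le_eqVlt; apply/orP; left; apply/eqP; apply: eq_integral => z _.
rewrite patchE /=; case: (small_jumpP z) => -[-> [z1 _]].
  by rewrite subrr mulr0 normr0 memNset //=; apply/negP; rewrite -ltNge.
by rewrite subr0 mulr1 ger0_norm ?powR_ge0 // mem_set.
Qed.

Section kernel.
Variables F G : R -> R.
Hypothesis dF : forall x : R, is_derive x 1 F (G x).
Hypothesis F_le1 : forall x, `|F x| <= 1.
Hypothesis G_le1 : forall x, `|G x| <= 1.
Hypothesis G_lip : forall x y, `|G x - G y| <= `|x - y|.

(** For [(F, G)] equal to [(cos, - sin)] or [(sin, cos)] this is the real or imaginary part of the
    Lévy-Khintchine integrand. *)
Definition jump_kernel (u z : 'rV[R]_d) : R :=
  F (dotp u z) - F 0 - G 0 * (dotp u z * small_jump z).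

Definition jump_integral (u : 'rV[R]_d) : R :=
  \int[nu]_z jump_kernel u (z : borelRd R d).

Lemma measurable_comp_dotp (f : R -> R) u : continuous f ->
  measurable_fun [set: borelRd R d] (fun z : borelRd R d => f (dotp u z)).
Proof.
move=> cf; apply: (measurableT_comp (continuous_measurable_fun cf)).
exact: measurable_dotp.
Qed.

Let continuousF : continuous F.
Proof. by move=> x; apply: differentiable_continuous; apply/derivable1_diffP. Qed.

Let continuousG : continuous G.
Proof.
move=> x; apply/cvgrPdist_le => e e0; near=> y.
apply: le_trans (G_lip _ _) _; near: y.
by exists e => //= y /ltW.
Unshelve. all: by end_near. Qed.

Lemma measurable_jump_kernel u :
  measurable_fun [set: borelRd R d] (jump_kernel u : borelRd R d -> R).
Proof.
apply: measurable_funB.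
  by apply: measurable_funB; [exact: measurable_comp_dotp|exact: measurable_cst].
apply: measurable_funM; first exact: measurable_cst.
by apply: measurable_funM; [exact: measurable_dotp|exact: measurable_small_jump].
Qed.

Lemma jump_kernel_holder al x y z : 0 <= al <= 1 -> al <= beta ->
  `|jump_kernel x z - jump_kernel y z| <=
  (2 * (enorm x + enorm y) * enorm (x - y) + 2 * enorm (x - y) `^ al) * moment z.
Proof.
move=> al01 al_beta; have [al0 al1] := andP al01.
have z_ge0 := enorm_ge0 z; have xy_ge0 := enorm_ge0 (x - y).
have dxy : dotp x z - dotp y z = dotp (x - y) z by rewrite dotpBl.
have [xz yz] := (ler_norm_dotp x z, ler_norm_dotp y z).
have xyz := ler_norm_dotp (x - y) z.
have pw_ge0 := powR_ge0 (enorm (x - y)) al.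
have xy0 : 0 <= 2 * (enorm x + enorm y) * enorm (x - y).
  by rewrite !mulr_ge0 ?addr_ge0 ?enorm_ge0.
rewrite /jump_kernel; case: (small_jumpP z) => -[-> [z1 mz]].
  rewrite !mulr1 (_ : _ - _ = F (dotp x z) - F (dotp y z)
    - G 0 * (dotp x z - dotp y z)); last by ring.
  apply: le_trans (kernel_compensated dF G_lip _ _) _; rewrite dxy [leRHS]mulrDl.
  apply: (@le_trans _ _ (2 * (enorm x + enorm y) * enorm (x - y) * enorm z ^+ 2)).
    rewrite [leRHS](_ : _ = 2 * (enorm x * enorm z + enorm y * enorm z) *
      (enorm (x - y) * enorm z)); last by ring.
    apply: ler_pM => //.
    by rewrite ler_wpM2l // lerD.
  apply: (@le_trans _ _ (2 * (enorm x + enorm y) * enorm (x - y) * moment z)).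
    exact: ler_wpM2l.
  by rewrite lerDl !mulr_ge0 ?moment_ge0.
(* Large jumps carry no compensator. The Hölder bound yields [enorm z]^ al[, at most]enorm z
   [^ beta] since [enorm z >= 1] and [al <= beta]. *)
rewrite !mulr0 !subr0 (_ : _ - _ = F (dotp x z) - F (dotp y z)); last by ring.
apply: le_trans (kernel_holder dF F_le1 G_le1 _ _ al01) _; rewrite dxy [leRHS]mulrDl.
apply: (@le_trans _ _ (2 * enorm (x - y) `^ al * moment z)); last first.
  by rewrite lerDr mulr_ge0 ?moment_ge0.
rewrite -mulrA ler_wpM2l //.
apply: (@le_trans _ _ ((enorm (x - y) * enorm z) `^ al)).
  by apply: ge0_ler_powR => //; rewrite nnegrE ?mulr_ge0.
rewrite powRM // ler_wpM2l //; apply: (@le_trans _ _ (enorm z `^ beta)).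
  by rewrite ler_powR.
by apply: le_trans mz; rewrite lerDr.
Qed.

Lemma jump_kernel0 z : jump_kernel 0 z = 0.
Proof. by rewrite /jump_kernel dotp0l mul0r mulr0 subrr subr0. Qed.

(** The increment bound is taken between [u] and 0, where the kernel vanishes, with the largest
    exponent it allows. *)
Lemma integrable_jump_kernel u :
  nu.-integrable setT (EFin \o (jump_kernel u : borelRd R d -> R)).
Proof.
pose al := Num.min beta 1.
have al01 : 0 <= al <= 1 by rewrite le_min ler01 (ltW beta_gt0) ge_min lexx orbT.
have alb : al <= beta by rewrite ge_min lexx.
apply: (le_integrableM integrable_moment (measurable_jump_kernel u)) => z.
by have := jump_kernel_holder u 0 z al01 alb; rewrite jump_kernel0 subr0; exact.
Qed.

Lemma jump_integral_holder al x y : 0 <= al <= 1 -> al <= beta ->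
  `|jump_integral x - jump_integral y| <=
  (2 * (enorm x + enorm y) * enorm (x - y) + 2 * enorm (x - y) `^ al) *
  \int[nu]_z moment (z : borelRd R d).
Proof.
move=> al01 al_beta; rewrite -RintegralB ?integrable_jump_kernel //.
apply: le_normr_RintegralM; first exact: integrable_moment.
  by apply: measurable_funB; exact: measurable_jump_kernel.
by move=> z; exact: jump_kernel_holder.
Qed.

(** * Differentiability of the jump integral when large jumps have a first moment *)

Hypothesis beta_ge1 : 1 <= beta.

Lemma enorm_le_moment z : small_jump z = 0 -> enorm z <= moment z.
Proof.
case: (small_jumpP z) => -[-> [z1 mz]] sz; first by move/eqP: sz; rewrite oner_eq0.
apply: (@le_trans _ _ (enorm z `^ beta)); first exact: le1r_powR.
by apply: le_trans mz; rewrite lerDr.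
Qed.

(** The bound of [kernel_taylor] at [s = dotp h z], for [enorm h <= r], once a factor [enorm h] is
    taken out. *)
Definition truncated_square (r : R) (z : 'rV[R]_d) : R :=
  Num.min (2 * enorm z) (r * enorm z ^+ 2).

Lemma measurable_truncated_square r :
  measurable_fun [set: borelRd R d] (truncated_square r : borelRd R d -> R).
Proof.
apply: measurable_minr; apply: measurable_funM; try exact: measurable_cst.
  exact: measurable_enorm.
by apply: measurable_funX; exact: measurable_enorm.
Qed.

Lemma truncated_square_ge0 r z : 0 <= r -> 0 <= truncated_square r z.
Proof. by move=> r0; rewrite le_min !mulr_ge0 ?enorm_ge0 ?sqr_ge0. Qed.

(** The quadratic branch is dominated on small jumps, the linear one on large jumps. *)
Lemma truncated_square_le r z : 0 <= r ->
  `|truncated_square r z| <= (2 + r) * moment z.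
Proof.
move=> r0; rewrite ger0_norm ?truncated_square_ge0 // /truncated_square.
have m0 := moment_ge0 z.
case: (small_jumpP z) => -[sz [z1 mz]]; rewrite ge_min; apply/orP; [right|left].
  apply: (@le_trans _ _ (r * moment z)); first exact: ler_wpM2l.
  by rewrite ler_wpM2r // lerDr.
apply: (@le_trans _ _ (2 * moment z)); last by rewrite ler_wpM2r // lerDl.
by rewrite ler_wpM2l // enorm_le_moment.
Qed.

Lemma integrable_truncated_square r : 0 <= r ->
  nu.-integrable setT (EFin \o (truncated_square r : borelRd R d -> R)).
Proof.
move=> r0; apply: (le_integrableM integrable_moment (measurable_truncated_square r)).
by move=> z; exact: truncated_square_le.
Qed.

Lemma Rintegral_truncated_square_small (e : R) : 0 < e ->
  exists2 r, 0 < r & \int[nu]_z truncated_square r (z : borelRd R d) <= e.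
Proof.
move=> e0.
have int_cvg0 :
    (\int[nu]_z (truncated_square n.+1%:R^-1 z)%:E)%E @[n --> \oo] --> 0%E.
  (* Dominated convergence along [r = 1 / (n + 1)]; as [r <= 1], the factor [2 + r] is at most 3. *)
  rewrite -(integral0 nu [set: borelRd R d]).
  apply: (@dominated_cvg _ _ _ nu _ measurableT _ _
      (fun z : borelRd R d => (3%:E * (moment z)%:E)%E)) => //.
  - by move=> n; apply/measurable_EFinP; exact: measurable_truncated_square.
  - move=> z _; apply: cvg_EFin; first exact: nearW.
    apply: (@squeeze_cvgr _ _ _ _ (cst 0) (fun n => n.+1%:R^-1 * enorm z ^+ 2)).
    + by apply: nearW => n; rewrite truncated_square_ge0 ?ge_min ?lexx ?orbT.
    + exact: cvg_cst.
    + rewrite -[X in _ --> X](mul0r (enorm z ^+ 2)).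
      by apply: cvgMl; exact: cvg_harmonic.
  - exact: (integrableZl _ _ integrable_moment).
  - move=> n z _; rewrite -EFinM /= lee_fin.
    apply: le_trans (truncated_square_le _ _) _ => //.
    rewrite ler_wpM2r ?moment_ge0 //.
    rewrite [leRHS](_ : 3 = 2 + 1); last by ring.
    by rewrite lerD2l invf_le1 // ler1n.
have /fine_cvgP [_ /cvgrPdist_le /(_ e e0)] := int_cvg0.
move=> [n _ /(_ n (leqnn n))] /=; rewrite sub0r normrN => le_e.
exists n.+1%:R^-1; first by rewrite invr_gt0.
exact: le_trans (ler_norm _) le_e.
Qed.

(** The scalar factor of [z] in the gradient of [jump_kernel] with respect to [u]. *)
Definition gradient_kernel (u z : 'rV[R]_d) : R := G (dotp u z) - G 0 * small_jump z.

Definition jump_gradient (u : 'rV[R]_d) : 'rV[R]_d :=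
  \row_i \int[nu]_z (gradient_kernel u z * (z : 'rV[R]_d) 0 i).

Lemma measurable_gradient_kernel u :
  measurable_fun [set: borelRd R d] (gradient_kernel u : borelRd R d -> R).
Proof.
apply: measurable_funB; first exact: measurable_comp_dotp.
by apply: measurable_funM; [exact: measurable_cst|exact: measurable_small_jump].
Qed.

(** On small jumps the Lipschitz bound on [G] supplies a second factor [enorm z]; on large ones
    [|G| <= 1] and the first moment suffice. *)
Lemma gradient_kernel_le u z :
  `|gradient_kernel u z| * enorm z <= (enorm u + 1) * moment z.
Proof.
have [z0 u0 m0] := And3 (enorm_ge0 z) (enorm_ge0 u) (moment_ge0 z).
rewrite /gradient_kernel; case: (small_jumpP z) => -[sz [z1 mz]]; rewrite sz.
  rewrite mulr1; apply: (@le_trans _ _ (enorm u * enorm z ^+ 2)).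
    rewrite expr2 mulrA ler_wpM2r //.
    by apply: le_trans (G_lip _ _) _; rewrite subr0; exact: ler_norm_dotp.
  by apply: ler_pM => //; rewrite ?sqr_ge0 // lerDl.
rewrite mulr0 subr0; apply: (@le_trans _ _ (1 * moment z)).
  by apply: ler_pM => //; exact: enorm_le_moment.
by rewrite ler_wpM2r // lerDr.
Qed.

Lemma integrable_gradient_kernelM u (f : 'rV[R]_d -> R) (C : R) :
  measurable_fun [set: borelRd R d] (f : borelRd R d -> R) ->
  (forall z, `|f z| <= C * enorm z) -> 0 <= C ->
  nu.-integrable setT
    (EFin \o (fun z : borelRd R d => gradient_kernel u z * f (z : 'rV[R]_d))).
Proof.
move=> mf fC C0.
apply: (@le_integrableM _ _ _ _ _ _ (C * (enorm u + 1)) integrable_moment).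
  by apply: measurable_funM => //; exact: measurable_gradient_kernel.
move=> z; rewrite -mulrA; apply: le_trans (ler_wpM2l C0 (gradient_kernel_le u z)).
by rewrite normrM mulrCA ler_wpM2l.
Qed.

Lemma integrable_gradient_dotp u v : nu.-integrable setT
  (EFin \o (fun z : borelRd R d => gradient_kernel u z * dotp v z)).
Proof.
apply: (integrable_gradient_kernelM _ (C := enorm v)).
- exact: measurable_dotp.
- by move=> z; exact: ler_norm_dotp.
- exact: enorm_ge0.
Qed.

(** Linearity of the integral recombines the coordinates, so a directional derivative becomes one
    integral that can be estimated pointwise. *)
Lemma dotp_jump_gradient u v :
  dotp (jump_gradient u) v =
  \int[nu]_z (gradient_kernel u z * dotp v (z : borelRd R d)).
Proof.
have icoord i : nu.-integrable setT
    (EFin \o (fun z : borelRd R d => gradient_kernel u z * (z : 'rV[R]_d) 0 i)).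
  apply: (@integrable_gradient_kernelM u (fun z => z 0 i) 1) => //.
    by apply: continuous_measurable_borelRd; exact: coord_continuous.
  move=> z; rewrite mul1r; apply: le_trans (ler_norm_enorm z).
  exact: ler_coord_norm.
transitivity (\int[nu]_z \sum_i v 0 i * (gradient_kernel u z * (z : 'rV[R]_d) 0 i)).
  rewrite Rintegral_sum; last by move=> i; exact: (integrableZl _ _ (icoord i)).
  by apply: eq_bigr => i _; rewrite mxE mulrC RintegralZl.
apply: eq_Rintegral => z _; rewrite /dotp mulr_sumr.
by apply: eq_bigr => i _; rewrite mulrCA.
Qed.

Lemma jump_integral_taylor u h r : enorm h <= r ->
  `|jump_integral (h + u) - jump_integral u - dotp (jump_gradient u) h| <=
  enorm h * \int[nu]_z truncated_square r (z : borelRd R d).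
Proof.
move=> hr; have h0 := enorm_ge0 h; have r0 := le_trans h0 hr.
rewrite dotp_jump_gradient -!RintegralB ?integrable_jump_kernel //; first last.
- exact: integrable_gradient_dotp.
- exact: (integrableB measurableT (integrable_jump_kernel _)
    (integrable_jump_kernel _)).
apply: le_normr_RintegralM; first exact: integrable_truncated_square.
  apply: measurable_funB.
    by apply: measurable_funB; exact: measurable_jump_kernel.
  apply: measurable_funM; last exact: measurable_dotp.
  exact: measurable_gradient_kernel.
move=> z; have hz := ler_norm_dotp h z; have z0 := enorm_ge0 z.
rewrite /jump_kernel /gradient_kernel dotpDl.
(* The compensator is linear in [u], so it cancels exactly against its share of the gradient. *)
rewrite (_ : _ - _ - _ = F (dotp h z + dotp u z) - F (dotp u z)
  - G (dotp u z) * dotp h z); last by ring.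
apply: le_trans (kernel_taylor dF G_le1 G_lip _ _) _.
rewrite /truncated_square minr_pMr // le_min !ge_min; apply/andP; split; apply/orP.
  by left; rewrite mulrCA ler_wpM2l.
right; apply: (@le_trans _ _ ((enorm h * enorm z) ^+ 2)).
  by rewrite ler_sqr ?nnegrE ?mulr_ge0.
by rewrite exprMn expr2 -mulrA ler_wpM2l // ler_wpM2r ?sqr_ge0.
Qed.

Lemma jump_gradient_modulus u v w r : enorm (u - v) <= r ->
  `|dotp (jump_gradient u) w - dotp (jump_gradient v) w| <=
  enorm w * \int[nu]_z truncated_square r (z : borelRd R d).
Proof.
move=> uvr; have uv0 := enorm_ge0 (u - v); have r0 := le_trans uv0 uvr.
rewrite !dotp_jump_gradient -RintegralB ?integrable_gradient_dotp //.
apply: le_normr_RintegralM; first exact: integrable_truncated_square.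
  by apply: measurable_funB; apply: measurable_funM;
    do ?[exact: measurable_dotp|exact: measurable_gradient_kernel].
move=> z; have wz := ler_norm_dotp w z; have [z0 w0] := (enorm_ge0 z, enorm_ge0 w).
rewrite /gradient_kernel -mulrBl.
rewrite (_ : _ - _ - _ = G (dotp u z) - G (dotp v z)); last by ring.
rewrite normrM /truncated_square minr_pMr // le_min; apply/andP; split.
  rewrite mulrCA; apply: ler_pM => //; apply: le_trans (ler_normB _ _) _.
  by have := G_le1 (dotp u z); have := G_le1 (dotp v z); lra.
rewrite (_ : _ * (_ * _) = r * enorm z * (enorm w * enorm z)); last by ring.
apply: ler_pM => //; apply: le_trans (G_lip _ _) _; rewrite -dotpBl.
by apply: le_trans (ler_norm_dotp _ _) _; rewrite ler_wpM2r.
Qed.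

End kernel.
End jump_integral.

(** Moduli at [t = 1] identify the real parts. One time fixes the imaginary part only modulo
    [2 * pi]; letting [t] vary removes the ambiguity. *)
Lemma cexp_line_inj {R : realType} (x y : R[i]) :
  (forall t : R, 0 <= t -> cexp (t%:C * x) = cexp (t%:C * y)) -> x = y.
Proof.
case: x y => [x1 x2] [y1 y2] exy.
have {exy} polar (t : R) : 0 <= t ->
    expR (t * x1) * cos (t * x2) = expR (t * y1) * cos (t * y2) /\
    expR (t * x1) * sin (t * x2) = expR (t * y1) * sin (t * y2).
  move=> /exy; rewrite /cexp /= !mul0r !subr0 !addr0 => -[].
  by rewrite !mul0r !subr0 !addr0.
have norm_exp (r p : R) :
    (expR r * cos p) ^+ 2 + (expR r * sin p) ^+ 2 = expR r ^+ 2.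
  by rewrite !exprMn -mulrDr cos2Dsin2 mulr1.
have x1y1 : x1 = y1.
  have [ec es] := polar 1 ler01; rewrite !mul1r in ec es.
  apply: expR_inj; apply/eqP; rewrite -(eqrXn2 (n := 2)) ?expR_ge0 //.
  by rewrite -(norm_exp _ x2) ec es norm_exp.
congr (_ +i* _) => //; apply/eqP; rewrite -subr_eq0; apply/negP => /negP xy0.
(* At this time the phases would differ by [pi] up to sign, so the cosine of their difference would
   be both 1 and -1. *)
have t_ge0 : 0 <= pi / `|x2 - y2| by rewrite divr_ge0 ?pi_ge0.
have [ec es] := polar _ t_ge0.
have e_neq0 : expR (pi / `|x2 - y2| * y1) != 0 by rewrite gt_eqF ?expR_gt0.
move: ec es; rewrite x1y1 => /(mulfI e_neq0) ec /(mulfI e_neq0) es.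
have : cos (pi / `|x2 - y2| * (x2 - y2)) = 1.
  by rewrite mulrBr cosB ec es -!expr2 cos2Dsin2.
have -> : cos (pi / `|x2 - y2| * (x2 - y2)) = -1.
  have [xy|xy] := leP 0 (x2 - y2).
    by rewrite ger0_norm // mulfVK // cospi.
  by rewrite ltr0_norm // invrN mulrN mulNr mulfVK // cosN cospi.
by lra.
Qed.

(** * Real and imaginary parts of the Lévy-Khintchine exponent *)

Section levy_khintchine_parts.
Context {R : realType} {d : nat} {nu : {measure set (borelRd R d) -> \bar R}}.
Variables (b : 'rV[R]_d) (Q : 'M[R]_d).

Lemma Re_levy_khintchine u : complex.Re (levy_khintchine b Q nu u) =
  - (2^-1 * dotp (u *m Q) u) + @jump_integral R d nu cos (fun x => - sin x) u.
Proof.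
rewrite /levy_khintchine /= !mul0r !mul1r !subr0 add0r; congr (_ + _).
apply: eq_Rintegral => z _.
rewrite /cexp /jump_kernel /= !mul0r !mul1r cos0 sin0.
by rewrite ?(oppr0, subr0, add0r, addr0, mul0r, mulr0, mul1r, expR0).
Qed.

Lemma Im_levy_khintchine u : complex.Im (levy_khintchine b Q nu u) =
  dotp b u + @jump_integral R d nu sin cos u.
Proof.
rewrite /levy_khintchine /= !mul0r !mul1r subr0 add0r; congr (_ + _).
apply: eq_Rintegral => z _.
rewrite /cexp /jump_kernel /= !mul0r !mul1r.
rewrite cos0 sin0.
by rewrite ?(subr0, add0r, addr0, mul0r, mulr0, mul1r, expR0).
Qed.

End levy_khintchine_parts.

(** * Matrix bounds and a gradient criterion for class C1 *)

Section regularity.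
Context {R : realType} {d : nat}.
Implicit Types (f : 'rV[R]_d -> R) (u v h : 'rV[R]_d) (Q : 'M[R]_d).

Lemma dotp_mulmx Q u v : dotp (u *m Q) v = dotp (v *m Q^T) u.
Proof.
have dotpE (x y : 'rV[R]_d) : dotp x y = (x *m y^T) 0 0.
  by rewrite mxE; apply: eq_bigr => i _; rewrite mxE.
by rewrite (dotpC _ u) !dotpE trmx_mul trmxK mulmxA.
Qed.

Definition mx_bound Q : R := \sum_j \sum_i `|Q i j|.

Lemma mx_bound_ge0 Q : 0 <= mx_bound Q.
Proof. by apply: sumr_ge0 => j _; apply: sumr_ge0. Qed.

Lemma ler_norm_dotp_mulmx Q u v :
  `|dotp (u *m Q) v| <= mx_bound Q * (enorm u * enorm v).
Proof.
have coord (w : 'rV[R]_d) i : `|w 0 i| <= enorm w.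
  exact: le_trans (ler_coord_norm w i) (ler_norm_enorm w).
rewrite /dotp mulr_suml; apply: le_trans (ler_norm_sum _ _ _) _.
apply: ler_sum => j _; rewrite mxE normrM mulr_suml.
apply: (@le_trans _ _ (\sum_i (`|u 0 i * Q i j|) * enorm v)).
  rewrite -mulr_suml; apply: ler_pM => //; exact: ler_norm_sum.
apply: ler_sum => i _; rewrite normrM mulrA ler_wpM2r ?enorm_ge0 //.
by rewrite mulrC ler_wpM2l.
Qed.

Lemma dotp_is_linear u : linear (dotp u : 'rV[R]_d -> R^o).
Proof. by move=> k v w; rewrite dotpDr dotpZr. Qed.

HB.instance Definition _ u :=
  GRing.isLinear.Build R 'rV[R]_d R^o _ (dotp u) (dotp_is_linear u).

Lemma nbhs_enorm (u : 'rV[R]_d) (r : R) : 0 < r ->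
  \forall w \near u, enorm (u - w) <= r.
Proof.
(* Neighbourhoods are those of the sup norm, and [k] bounds the Euclidean norm by it; the added 1
   keeps [k] positive when [d = 0]. *)
move=> r0; pose k : R := Num.sqrt d%:R + 1.
have k0 : 0 < k by rewrite ltr_wpDl // sqrtr_ge0.
apply/nbhs_normP; exists (k^-1 * r); first by rewrite /= mulr_gt0 ?invr_gt0.
move=> w /= /ltW; rewrite ler_pdivlMl // => /(le_trans _); apply.
by apply: le_trans (ler_enorm_norm _) _; rewrite ler_wpM2r // lerDl.
Qed.

Lemma continuous_enormP (f : 'rV[R]_d -> R) :
  (forall u (e : R), 0 < e -> exists2 r, 0 < r & forall w, enorm (u - w) <= r ->
    `|f u - f w| <= e) -> continuous f.
Proof.
move=> f_cont u; have FFu : Filter (nbhs u) := nbhs_filter u.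
apply/cvgrPdist_le => e e0; have [r r0 fr] := f_cont u e e0.
by apply: filterS (nbhs_enorm u r0) => w; exact: fr.
Qed.

(** A Euclidean remainder bound with tolerance [e / k] gives the little-o expansion in the sup norm;
    uniqueness of the differential then identifies it with [dotp (g u)]. *)
Lemma C1_gradient (f : 'rV[R]_d -> R^o) (g : 'rV[R]_d -> 'rV[R]_d) :
  (forall u (e : R), 0 < e -> exists2 r, 0 < r & forall h, enorm h <= r ->
    `|f (h + u) - f u - dotp (g u) h| <= e * enorm h) ->
  (forall v, continuous (fun u => dotp (g u) v)) ->
  C1 f.
Proof.
move=> f_taylor g_cont; pose k : R := Num.sqrt d%:R + 1.
have k0 : 0 < k by rewrite ltr_wpDl // sqrtr_ge0.
have dotp_cont u : continuous (dotp u : 'rV[R]_d -> R^o).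
  by rewrite (_ : dotp u = fun v => dotp v u);
    [exact: continuous_dotp|apply/funext => v; exact: dotpC].
pose df u : {linear 'rV[R]_d -> R^o} := dotp (g u).
have f_expand (u : 'rV[R]_d) :
    f \o shift u = cst (f u) + df u +o_ (0 : 'rV[R]_d) id.
  apply/eqaddoP => e e0; have [r r0 fr] := f_taylor u (e / k) (divr_gt0 e0 k0).
  apply: filterS (nbhs_enorm 0 r0) => h; rewrite sub0r enormN => /fr.
  rewrite -[X in _ -> `|X| <= _]/(f (h + u) - (f u + dotp (g u) h)) opprD addrA.
  move=> /le_trans; apply; rewrite mulrAC ler_pdivrMr // -mulrA.
  rewrite ler_wpM2l ?(ltW e0) // mulrC.
  by apply: le_trans (ler_enorm_norm _) _; rewrite ler_wpM2r // lerDl.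
have dfE u : 'd f u = dotp (g u) :> ('rV[R]_d -> R^o).
  exact: diff_unique (dotp_cont _) (f_expand u).
split=> [u|v]; first by apply/diff_locallyP; rewrite dfE; split.
rewrite (_ : (fun x => _) = fun u => dotp (g u) v); first exact: g_cont.
by apply/funext => u; rewrite dfE.
Qed.

End regularity.

(** * Class C1 for sums, linear forms and quadratic forms *)

Section C1_components.
Context {R : realType} {d : nat}.

Lemma C1D (f g : 'rV[R]_d -> R^o) : C1 f -> C1 g -> C1 (fun u => f u + g u).
Proof.
move=> [df cf] [dg cg].
split=> [u|v]; first exact: (differentiableD (df u) (dg u)).
rewrite (_ : (fun x => _) = fun u => 'd f u v + 'd g u v).
  move=> u; apply: (@continuousD R R^o 'rV[R]_d
    (fun u => 'd f u v) (fun u => 'd g u v)); [exact: cf|exact: cg].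
by apply/funext => u; rewrite (diffD (df u) (dg u)).
Qed.

Lemma C1_dotp (b : 'rV[R]_d) : C1 (dotp b : 'rV[R]_d -> R^o).
Proof.
apply: (C1_gradient (g := fun=> b)) => [u e e0|v]; last exact: cst_continuous.
exists 1 => // h _; rewrite dotpDr addrK subrr normr0.
by rewrite mulr_ge0 ?enorm_ge0 // ltW.
Qed.

Lemma C1_quadratic (a : R) (Q : 'M[R]_d) :
  C1 (fun u : 'rV[R]_d => a * dotp (u *m Q) u : R^o).
Proof.
apply: (C1_gradient (g := fun u => a *: (u *m (Q + Q^T)))) => [u e e0|v].
  pose K := `|a| * mx_bound Q.
  have K0 : 0 <= K by rewrite mulr_ge0 ?mx_bound_ge0.
  (* The remainder is exactly [a * dotp (h *m Q) h], at most [K * enorm h ^+ 2]; the added 1 avoids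
     dividing by zero. *)
  exists (e / (K + 1)) => [|h hr]; first by rewrite divr_gt0 ?ltr_wpDl.
  have -> : a * dotp ((h + u) *m Q) (h + u) - a * dotp (u *m Q) u -
      dotp (a *: (u *m (Q + Q^T))) h = a * dotp (h *m Q) h.
    rewrite dotpZl mulmxDr !mulmxDl !dotpDl !dotpDr (dotp_mulmx Q h u); ring.
  rewrite normrM; apply: (@le_trans _ _ (K * enorm h * enorm h)).
    by rewrite -!mulrA ler_wpM2l // ler_norm_dotp_mulmx.
  rewrite ler_wpM2r ?enorm_ge0 //.
  move: hr; rewrite ler_pdivlMr ?ltr_wpDl // mulrC; apply: le_trans.
  by rewrite ler_wpM2r ?enorm_ge0 // lerDl.
rewrite (_ : (fun u => _) = fun u => dotp u (a *: (v *m (Q + Q^T)^T))).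
  exact: continuous_dotp.
by apply/funext => u; rewrite dotpZl dotpZr dotp_mulmx dotpC.
Qed.

End C1_components.

(** * Regularity of the Lévy-Khintchine exponent *)

Section exponent_parts.
Context {R : realType} {d : nat} {nu : {measure set (borelRd R d) -> \bar R}}.
Variable beta : R.
Hypothesis beta_gt0 : 0 < beta.
Hypothesis nu_min :
  (\int[nu]_z (Num.min 1 (enorm (z : 'rV[R]_d) ^+ 2))%:E < +oo)%E.
Hypothesis nu_moment :
  (\int[nu]_(z in [set z : borelRd R d | (1 <= enorm (z : 'rV[R]_d))%R])
    (enorm (z : 'rV[R]_d) `^ beta)%:E < +oo)%E.

Lemma sin_lipschitz (x y : R) : `|sin x - sin y| <= `|x - y|.
Proof. exact: (kernel_lipschitz (@is_derive_sin R) (@cos_max R)). Qed.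

Lemma Nsin_max (x : R) : `|- sin x| <= 1.
Proof. by rewrite normrN sin_max. Qed.

Lemma Nsin_lipschitz (x y : R) : `|- sin x - - sin y| <= `|x - y|.
Proof. by rewrite opprK addrC distrC sin_lipschitz. Qed.

Lemma cos_lipschitz (x y : R) : `|cos x - cos y| <= `|x - y|.
Proof. exact: (kernel_lipschitz (@is_derive_cos R) Nsin_max). Qed.

Lemma C1_jump_integral (F G : R -> R) :
  (forall x : R, is_derive x 1 F (G x)) -> (forall x, `|F x| <= 1) ->
  (forall x, `|G x| <= 1) -> (forall x y, `|G x - G y| <= `|x - y|) ->
  1 <= beta -> C1 (@jump_integral R d nu F G : _ -> R^o).
Proof.
move=> dF F1 G1 Glip beta1.
have small (e : R) : 0 < e -> exists2 r, 0 < r &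
    \int[nu]_z truncated_square r (z : borelRd R d) <= e.
  exact: (Rintegral_truncated_square_small nu_min nu_moment beta1).
apply: (C1_gradient (g := @jump_gradient R d nu G)) => [u e e0|v].
  have [r r0 re] := small e e0; exists r => // h hr.
  apply: le_trans (jump_integral_taylor beta_gt0 nu_min nu_moment
    dF F1 G1 Glip beta1 u hr) _.
  by rewrite mulrC ler_wpM2r ?enorm_ge0.
apply: continuous_enormP => u e e0; have v0 := enorm_ge0 v.
have [|r r0 re] := small (e / (enorm v + 1)); first by rewrite divr_gt0 ?ltr_wpDl.
exists r => // w uwr.
apply: le_trans (jump_gradient_modulus nu_min nu_moment G1 Glip beta1 v uwr) _.
have I0 : 0 <= \int[nu]_z truncated_square r (z : borelRd R d).
  by apply: Rintegral_ge0 => z _; exact/truncated_square_ge0/ltW.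
move: re; rewrite ler_pdivlMr ?ltr_wpDl // mulrC; apply: le_trans.
by rewrite ler_wpM2r // lerDl.
Qed.

Lemma normc_le (z : R[i]) :
  ComplexField.Normc.normc z <= `|complex.Re z| + `|complex.Im z|.
Proof.
case: z => x y /=.
rewrite -ler_sqr ?nnegrE ?addr_ge0 ?sqrtr_ge0 // sqr_sqrtr ?addr_ge0 ?sqr_ge0 //.
rewrite sqrrD !real_normK ?num_real // lerD2r lerDl.
by rewrite mulrn_wge0 // mulr_ge0.
Qed.

Lemma locally_holder_growth (f : 'rV[R]_d -> R[i]) (al K : R) :
  0 <= al <= 1 -> 0 <= K ->
  (forall x y, ComplexField.Normc.normc (f x - f y) <=
    K * ((1 + enorm x + enorm y) * enorm (x - y) + enorm (x - y) `^ al)) ->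
  locally_holder al f.
Proof.
move=> al01 K0 fK B [M0 [M0real BM]].
(* Boundedness holds in the sup norm for every bound strictly above [M0], hence the added 1; the
   square root passes to the Euclidean norm. *)
pose M := Num.sqrt d%:R * (Num.max M0 0 + 1).
have M_ge0 : 0 <= M by rewrite mulr_ge0 ?sqrtr_ge0 // addr_ge0 // le_max lexx orbT.
have B_le x : B x -> enorm x <= M.
  move=> Bx; apply: le_trans (ler_enorm_norm x) _; rewrite ler_wpM2l ?sqrtr_ge0 //.
  by apply: BM => //; rewrite ltr_pwDr // le_max lexx.
(* One factor [1 + M + M] bounds the growth coefficient, the other bounds [enorm (x - y)] in
   [le_powR_mul]; the last 1 is for the Hölder term. *)
exists (K * ((1 + M + M) * (1 + M + M) + 1)) => x y /B_le xM /B_le yM.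
apply: le_trans (fK x y) _; rewrite -mulrA ler_wpM2l // [leRHS]mulrDl mul1r lerD2r.
have r0 := enorm_ge0 (x - y); have xyM := ler_enormB x y.
apply: (@le_trans _ _ ((1 + M + M) * enorm (x - y))).
  by rewrite ler_wpM2r // !lerD.
rewrite -mulrA ler_wpM2l; [|lra|]; first by lra.
by apply: le_powR_mul => //; lra.
Qed.

Variables (b : 'rV[R]_d) (Q : 'M[R]_d).
Let eta := levy_khintchine b Q nu.

Lemma C1_levy_khintchine : 1 <= beta -> C1_complex eta.
Proof.
move=> beta1; split.
  rewrite (_ : (fun x => _) = fun u => (- 2^-1) * dotp (u *m Q) u +
      @jump_integral R d nu cos (fun x => - sin x) u); last first.
    by apply/funext => u; rewrite Re_levy_khintchine mulNr.
  apply: C1D; first exact: C1_quadratic.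
  by apply: C1_jump_integral => //;
    [exact: cos_max|exact: Nsin_max|exact: Nsin_lipschitz].
rewrite (_ : (fun x => _) = fun u => dotp b u + @jump_integral R d nu sin cos u).
  apply: C1D; first exact: C1_dotp.
  by apply: C1_jump_integral => //;
    [exact: sin_max|exact: cos_max|exact: cos_lipschitz].
by apply/funext => u; rewrite Im_levy_khintchine.
Qed.

(** The index stays free: [al = beta] serves the Hölder claim and [al = 1] the Lipschitz one. *)
Lemma locally_holder_levy_khintchine al :
  0 <= al <= 1 -> al <= beta -> locally_holder al eta.
Proof.
move=> al01 al_beta; pose I := \int[nu]_z moment beta (z : borelRd R d).
have I0 : 0 <= I by apply: Rintegral_ge0 => z _; exact: moment_ge0.
have jump F G : (forall x : R, is_derive x 1 F (G x)) -> (forall x, `|F x| <= 1) ->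
    (forall x, `|G x| <= 1) -> (forall x y, `|G x - G y| <= `|x - y|) ->
    forall x y, `|@jump_integral R d nu F G x - @jump_integral R d nu F G y| <=
    2 * I * ((1 + enorm x + enorm y) * enorm (x - y) + enorm (x - y) `^ al).
  move=> dF F1 G1 Glip x y.
  apply: le_trans (jump_integral_holder beta_gt0 nu_min nu_moment
    dF F1 G1 Glip x y al01 al_beta) _.
  rewrite -/I [leRHS]mulrAC ler_wpM2r // -mulrA -mulrDr ler_wpM2l // lerD2r.
  by rewrite ler_wpM2r ?enorm_ge0 // lerD2r lerDr.
have cosI := jump _ _ (@is_derive_cos R) (@cos_max R) Nsin_max Nsin_lipschitz.
have sinI := jump _ _ (@is_derive_sin R) (@sin_max R) (@cos_max R) cos_lipschitz.
have Q0 := mx_bound_ge0 Q; have b0 := enorm_ge0 b.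
(* [mx_bound Q] pays for the Gaussian part, [enorm b] for the drift, and [2 * I] for each of the two
   jump integrals. *)
apply: (@locally_holder_growth _ _ (mx_bound Q + enorm b + 2 * (2 * I))) => //.
  by rewrite !addr_ge0 ?mulr_ge0.
move=> x y; apply: le_trans (normc_le _) _;
have ReB (z w : R[i]) : complex.Re (z - w) = complex.Re z - complex.Re w.
  by case: z w => ? ? [].
have ImB (z w : R[i]) : complex.Im (z - w) = complex.Im z - complex.Im w.
  by case: z w => ? ? [].
rewrite ReB ImB /eta !Re_levy_khintchine !Im_levy_khintchine.
have {cosI}cosxy := cosI x y; have {sinI}sinxy := sinI x y.
have r0 := enorm_ge0 (x - y); have [x0 y0] := (enorm_ge0 x, enorm_ge0 y).
have p0 := powR_ge0 (enorm (x - y)) al.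
set S := (_ * enorm (x - y) + _) in cosxy sinxy *.
have Qxy : `|dotp (x *m Q) x - dotp (y *m Q) y| <= mx_bound Q * S.
  have -> : dotp (x *m Q) x - dotp (y *m Q) y =
      dotp ((x - y) *m Q) x + dotp (y *m Q) (x - y).
    rewrite mulmxBl dotpBl (dotpC _ (x - y)) dotpBl !(dotpC _ (y *m Q)); ring.
  apply: le_trans (ler_normD _ _) _.
  apply: le_trans (lerD (ler_norm_dotp_mulmx Q _ _) (ler_norm_dotp_mulmx Q _ _)) _.
  by rewrite -mulrDr ler_wpM2l // /S; nra.
(* The summand 1 in the growth coefficient of [S] is what dominates this linear term. *)
have bxy : `|dotp b x - dotp b y| <= enorm b * S.
  rewrite !(dotpC b) -dotpBl dotpC; apply: le_trans (ler_norm_dotp _ _) _.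
  by rewrite ler_wpM2l // /S; nra.
rewrite (_ : _ * S = (mx_bound Q + 2 * I) * S + (enorm b + 2 * I) * S); last by ring.
move: cosxy sinxy Qxy bxy; rewrite !ler_norml.
move=> /andP[? ?] /andP[? ?] /andP[? ?] /andP[? ?].
by apply: lerD; rewrite ler_norml; apply/andP; split; lra.
Qed.

End exponent_parts.

Theorem proposition7 (R : realType) (d : nat) (dT : measure_display)
    (T : measurableType dT) (P : probability T R)
    (L : R -> T -> 'rV[R]_d) (psi : 'rV[R]_d -> R[i])
    (nu : {measure set (borelRd R d) -> \bar R}) (beta : R)
    (hL : levy_process P L)
    (hpsi : characteristic_exponent P L psi)
    (hnu : levy_measure P L nu)
    (hbeta : 0 < beta)
    (hmoment : (\int[nu]_(z in [set z : borelRd R d | (1 <= enorm (z : 'rV[R]_d))%R])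
                  (enorm (z : 'rV[R]_d) `^ beta)%:E < +oo)%E) :
  (1 <= beta -> C1_complex psi /\ locally_lipschitz psi) /\
  (beta < 1 -> locally_holder beta psi).
Proof.
have [_ nu_min [b [Q [_ _ LK]]]] := hnu; have [_ _ psiE] := hpsi.
have -> : psi = levy_khintchine b Q nu.
  apply/funext => u; apply: cexp_line_inj => t t0.
  by rewrite -psiE // LK.
split=> [beta1|/ltW beta1]; last first.
  by apply: (locally_holder_levy_khintchine hbeta nu_min hmoment) => //; rewrite ltW.
split; first exact: (C1_levy_khintchine hbeta nu_min hmoment).
(* The Lipschitz bound is the Hölder bound of index 1. *)
have : locally_holder 1 (levy_khintchine b Q nu).
  apply: (locally_holder_levy_khintchine hbeta nu_min hmoment) => //.
  by rewrite ler01 lexx.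
move=> holder1 B bB; have [C holderC] := holder1 B bB; exists C => x y Bx By.
by have := holderC x y Bx By; rewrite powRr1 ?enorm_ge0.
Qed.
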